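(* Let $\mathbb{F}_q$ be the finite field with $q$ elements and characteristic $p$. Let $k$ be an integer with $3 \leq k \leq q-2$ if $q$ is odd, and $4 \leq k \leq q-3$ if $q$ is even. Let $$h(x_1,\dots,x_k) = \sum_{e=0}^m a_e h_e(x_1,\dots,x_k) \in \mathbb{F}_q[x_1,\dots,x_k]$$ be a complete symmetric polynomial of positive degree $m$ (so $m \geq 1$, $a_e\in\mathbb{F}_q$, $a_m \neq 0$). Assume that either $k \leq p$ or $k \geq \lfloor (q+1)/2 \rfloor$. Then $N_q^*(h) \geq 1$ if and only if the reduction of the univariate polynomial $x^{k-1}\left(\sum_{e=0}^m a_e x^e\right)$ modulo $x^q - x$ is not a polynomial of degree equal to $k-1$.
   Context: For $e \geq 0$, the homogeneous complete symmetric polynomial of degree $e$ in the variables $x_1,\dots,x_k$ is $$h_e(x_1,\dots,x_k) = \sum_{1 \leq i_1 \leq i_2 \leq \cdots \leq i_e \leq k} x_{i_1} x_{i_2} \cdots x_{i_e},$$ with $h_0 = 1$. A complete symmetric polynomial of degree $m$ over $\mathbb{F}_q$ in $k$ variables is a linear combination $h = \sum_{e=0}^m a_e h_e(x_1,\dots,x_k)$ with $a_e \in \mathbb{F}_q$ and $a_m \neq 0$. For such $h$, $$N_q^*(h) = \#\{(x_1,\dots,x_k) \in \mathbb{F}_q^k \mid h(x_1,\dots,x_k) = 0 \text{ and } x_i \neq x_j \text{ for all } i \neq j\}.$$ The reduction of a polynomial in $\mathbb{F}_q[x]$ modulo $x^q - x$ is its remainder on division by $x^q-x$, i.e. the unique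 polynomial of degree at most $q-1$ (possibly zero) congruent to it modulo $x^q-x$; the zero polynomial is not of degree $k-1$. *)

(* Defs.v *)
From HB Require Import structures.
From mathcomp Require Export all_boot all_order all_algebra all_field.
From mathcomp.multinomials Require Export mpoly.

Set Implicit Arguments.
Unset Strict Implicit.
Unset Printing Implicit Defensive.

Import GRing.Theory.

Local Open Scope ring_scope.

(* The index (i_1, ..., i_e) is a nondecreasing e-tuple of elements of 'I_k;
   variables are numbered from 0. *)
Definition complete_homogeneous (R : comNzRingType) (k e : nat) : {mpoly R[k]} :=
  \sum_(t : e.-tuple 'I_k | sorted leq (map val t)) \prod_(i <- t) 'X_i.

(* Has degree m as a complete symmetric polynomial when a m != 0; the values
   a e with e > m are not used. *)
Definition complete_symmetric (R : comNzRingType) (k m : nat) (a : nat -> R) :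
    {mpoly R[k]} :=
  \sum_(e < m.+1) a e *: complete_homogeneous R k e.

Definition Nstar (F : finFieldType) (k : nat) (h : {mpoly F[k]}) : nat :=
  #|[set x : {ffun 'I_k -> F} |
      (h.@[x] == 0) && [forall i, forall j, (i != j) ==> (x i != x j)]]|.

Definition reduction (F : finFieldType) (g : {poly F}) : {poly F} :=
  g %% ('X^#|F| - 'X).

(* Main.v *)
Require Import Defs.
From mathcomp Require Import ring zify.

Set Implicit Arguments.
Unset Strict Implicit.
Unset Printing Implicit Defensive.

Import GRing.Theory.

Local Open Scope ring_scope.

(* At distinct points h_e(x_1, ..., x_k) is the divided difference of x^(e+k-1),
   so h vanishes at some point with distinct coordinates iff some divided
   difference over k points of g, the reduction of x^(k-1) sum_e a_e x^e, is 0.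
   The point is that if g has no zero divided difference over k points, then all
   those over k+1 points vanish, i.e. deg g = k-1.

   For 2k >= q, put r = q-k and let L(P) = sum_x g(x) P(x). As
   prod_(y != x) (x - y) does not depend on x, the divided difference over C is,
   up to a constant, L(prod_(s notin C) (X - s)). So L is nonzero on products of
   r distinct linear factors, and one must show that it kills products of r-1.
   After fixing r-2 factors this is a question on a bilinear form with small
   zero set.

   For k <= p and 2k <= q+2, the argument is that of Segre and Ball. For A of
   size k-2, x |-> g[A, x] is injective off A; interpolating the monic
   polynomial of degree k-2 that vanishes at its missed values gives a linear system for
   the products of divided differences below. It is the one satisfied by
   x^(k-1), and its matrix, the inclusion matrix of (k-2)-subsets against
   (k-1)-subsets of a (2k-3)-set, is invertible in characteristic p >= k. *)

(** * Divided differences *)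

Section DividedDifferences.
Variable F : finFieldType.
Implicit Types (f : F -> F) (C S : {set F}) (P : {poly F}).

Definition divdiff f C := \sum_(x in C) f x / \prod_(y in C :\ x) (x - y).

Lemma prod_subr_neq0 x S : x \notin S -> \prod_(y in S) (x - y) != 0.
Proof.
move=> xS; apply/prodf_neq0 => y yS; rewrite subr_eq0.
by apply: contraNneq xS => ->.
Qed.

Lemma eq_divdiff f1 f2 C : f1 =1 f2 -> divdiff f1 C = divdiff f2 C.
Proof. by move=> eqf; apply: eq_bigr => x _; rewrite eqf. Qed.

Lemma divdiffD f1 f2 C :
  divdiff (fun x => f1 x + f2 x) C = divdiff f1 C + divdiff f2 C.
Proof. by rewrite -big_split; apply: eq_bigr => x _; rewrite mulrDl. Qed.

Lemma divdiffZ a f C : divdiff (fun x => a * f x) C = a * divdiff f C.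
Proof. by rewrite mulr_sumr; apply: eq_bigr => x _; rewrite mulrA. Qed.

Lemma divdiff_sum (I : Type) (r : seq I) (f : I -> F -> F) C :
  divdiff (fun x => \sum_(i <- r) f i x) C = \sum_(i <- r) divdiff (f i) C.
Proof.
by rewrite exchange_big; apply: eq_bigr => x _; rewrite mulr_suml.
Qed.

(** The factor x - c kills the term at c and cancels against the denominator of every other term. *)
Lemma divdiff_mul_subr f c C : c \in C ->
  divdiff (fun x => (x - c) * f x) C = divdiff f (C :\ c).
Proof.
move=> cC; rewrite /divdiff (big_setD1 c cC)/= subrr !mul0r add0r.
apply: eq_bigr => x /setD1P[xc xC].
have cCx : c \in C :\ x by rewrite !inE eq_sym xc.
rewrite (big_setD1 c cCx)/= setDDl setUC -setDDl invfM mulrACA.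
by rewrite mulfV ?subr_eq0// mul1r.
Qed.

Lemma divdiff_mulX f c C : c \in C ->
  divdiff (fun x => x * f x) C = divdiff f (C :\ c) + c * divdiff f C.
Proof.
move=> cC; rewrite -divdiff_mul_subr// -divdiffZ -divdiffD.
by apply: eq_divdiff => x; rewrite -mulrDl subrK.
Qed.

Lemma divdiff_rec f c c' C : c \in C -> c' \in C ->
  (c - c') * divdiff f C = divdiff f (C :\ c') - divdiff f (C :\ c).
Proof.
move=> cC c'C; apply/eqP.
rewrite mulrBl subr_eq addrAC eq_sym subr_eq [eqbRHS]addrC.
by rewrite -(divdiff_mulX f cC) -(divdiff_mulX f c'C).
Qed.

(** For j = 0 and at least two nodes, removing either of two nodes gives the same value by induction
    on the size of C, so [divdiff_rec] gives 0. The step in j is [divdiff_mulX]. *)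
Lemma divdiff_Xn j C : (j < #|C|)%N ->
  divdiff (fun x => x ^+ j) C = (j.+1 == #|C|)%:R.
Proof.
elim: j C => [|j IHj] C.
  move: {2}#|C| (leqnn #|C|) => n; elim: n C => [|n IHn] C; first by case: #|C|.
  move=> leCn C0; have [C1|C1] := eqVneq 1%N #|C|.
    have /cards1P[x ->] : #|C| == 1%N by rewrite -C1.
    by rewrite /divdiff big_set1 setDv big_set0 invr1 mulr1.
  have /card_gt1P[x [y [xC yC xy]]] : (1 < #|C|)%N by rewrite ltn_neqAle C1.
  have eqD z : z \in C ->
      divdiff (fun x => x ^+ 0) (C :\ z) = (1%N == #|C|.-1)%:R.
    move=> zC; have cardC : #|C| = #|C :\ z|.+1 by rewrite (cardsD1 z C) zC.
    rewrite IHn ?cardC// -ltnS -cardC//.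
    by rewrite ltn_neqAle C1.
  have := divdiff_rec (fun x => x ^+ 0) xC yC.
  rewrite !eqD// subrr => /eqP; rewrite mulf_eq0 subr_eq0 (negPf xy)/=.
  by move=> /eqP.
move=> jC; have /card_gt0P[c cC] : (0 < #|C|)%N by apply: leq_ltn_trans jC.
have cardC : #|C| = #|C :\ c|.+1 by rewrite (cardsD1 c C) cC.
rewrite -(eq_divdiff _ (fun x => esym (exprS x j))) (divdiff_mulX _ cC) !IHj//.
- by rewrite (ltn_eqF jC) mulr0 addr0 cardC eqSS.
- exact: ltnW.
- by rewrite -ltnS -cardC.
Qed.

Lemma divdiff_horner P C : (size P <= #|C|)%N ->
  divdiff (horner P) C = P`_#|C|.-1.
Proof.
move=> sPC.
rewrite (eq_divdiff _ (fun x => horner_coef_wide x sPC)) divdiff_sum.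
rewrite (eq_bigr (fun i : 'I_#|C| => P`_i * (i.+1 == #|C|)%:R)); last first.
  by move=> i _; rewrite divdiffZ divdiff_Xn.
case C0 : #|C| => [|n]; last first.
  rewrite big_ord_recr/= eqxx mulr1 big1 ?add0r// => i _.
  by rewrite eqSS (ltn_eqF (ltn_ord i)) mulr0.
(* On the empty set [#|C|.-1] is 0, and the size bound forces P to be zero. *)
by rewrite big_ord0 nth_default//= -C0.
Qed.

End DividedDifferences.

(** * Complete homogeneous polynomials as divided differences of powers *)

Section CompleteHomogeneous.
Variables (F : finFieldType) (k : nat) (x : 'I_k -> F).

(** This is h_e in the variables of index at least i. Taking i in the natural numbers allows i = k,
    the empty family, which the recurrence reaches. *)
Let hsum e i :=
  \sum_(t : e.-tuple 'I_k | path leq i (map val t)) \prod_(j <- t) x j.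

Lemma hsumS e i :
  hsum e.+1 i = \sum_(j < k | (i <= j)%N) x j * hsum e j.
Proof.
rewrite (eq_bigr _ (fun j _ => mulr_sumr _ _ _ _)) /hsum.
rewrite pair_big_dep/=.
rewrite (reindex (fun p : 'I_k * e.-tuple 'I_k => [tuple of p.1 :: p.2]))/=.
  by apply: eq_bigr => p _; rewrite big_cons.
exists (fun t : e.+1.-tuple 'I_k => (thead t, [tuple of behead t])).
  by case=> j t _; congr (_, _); apply: val_inj.
by move=> t _; rewrite /= -tuple_eta.
Qed.

Lemma hsum0 i : hsum 0 i = 1.
Proof.
rewrite /hsum (big_pred1 [tuple]) ?big_nil// => t.
by rewrite /= (tuple0 t)/= eqxx.
Qed.

Lemma hsum_rec e (i : 'I_k) : hsum e.+1 i = hsum e.+1 i.+1 + x i * hsum e i.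
Proof.
rewrite !hsumS (bigD1 i)//= addrC; congr (_ + _); apply: eq_bigl => j.
by rewrite ltn_neqAle eq_sym andbC.
Qed.

Let tail i := [set x j | j : 'I_k & (i <= j)%N].

Lemma mem_tail (i : 'I_k) : x i \in tail i.
Proof. by apply: imset_f; rewrite inE. Qed.

Hypothesis xI : injective x.

Lemma tailD1 (i : 'I_k) : tail i :\ x i = tail i.+1.
Proof.
apply/setP => y; rewrite !inE; apply/andP/imsetP.
  case=> yi /imsetP[j]; rewrite inE => ij def_y.
  exists j => //; rewrite inE ltn_neqAle ij andbT.
  by apply: contraNneq yi => /val_inj ->; rewrite def_y.
case=> j; rewrite inE => ij ->; split; last by rewrite imset_f// inE ltnW.
by rewrite (inj_eq xI) -val_eqE gtn_eqF.
Qed.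

Lemma tail_oversize i : (k <= i)%N -> tail i = set0.
Proof.
move=> ki; apply/setP => y; rewrite inE; apply/imsetP => -[j].
by rewrite inE leqNgt (leq_trans (ltn_ord j)).
Qed.

Lemma card_tail i n : k = (i + n)%N -> #|tail i| = n.
Proof.
elim: n i => [|n IHn] i def_k.
  by rewrite tail_oversize ?cards0// def_k addn0.
have lt_ik : (i < k)%N by rewrite def_k -addSnnS leq_addr.
rewrite (cardsD1 (x (Ordinal lt_ik))) mem_tail.
by rewrite (tailD1 (Ordinal lt_ik)) (IHn i.+1)// addSnnS.
Qed.

(** [hsum_rec] and [divdiff_mulX] at the node x i are the same recurrence. The induction is on n,
    where n + 1 variables are left, then on e. *)
Lemma hsum_divdiff e n i : k = (i + n.+1)%N ->
  hsum e i = divdiff (fun y => y ^+ (e + n)) (tail i).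
Proof.
elim: n i e => [|n IHn] i e def_k.
all: have lt_ik : (i < k)%N by rewrite def_k -addSnnS leq_addr.
all: pose i' := Ordinal lt_ik; elim: e => [|e IHe].
1,3: by rewrite hsum0 divdiff_Xn (card_tail def_k)// eqxx.
all: rewrite (hsum_rec e i') IHe addSn.
all: rewrite (eq_divdiff _ (fun y => exprS y _)).
all: rewrite (divdiff_mulX _ (mem_tail i')) (tailD1 i'); congr (_ + _).
  (* With a single variable left, the summand without the factor x i is zero on both sides. *)
  have le_ki : (k <= i.+1)%N by rewrite def_k addn1.
  rewrite tail_oversize// /divdiff big_set0 hsumS big1// => j.
  by rewrite leqNgt (leq_trans (ltn_ord j)).
by rewrite (IHn i.+1) ?addSnnS// addnS.
Qed.
End CompleteHomogeneous.

Lemma meval_complete_symmetric (F : finFieldType) (k m : nat) (a : nat -> F)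
    (x : 'I_k -> F) : (0 < k)%N -> injective x ->
  (complete_symmetric k m a).@[x] =
  divdiff (horner ('X^(k - 1) * \sum_(e < m.+1) a e *: 'X^e))
    [set x j | j : 'I_k].
Proof.
case: k x => // k x _ xI.
rewrite (eq_divdiff (f2 := fun y => \sum_(e < m.+1) a e * y ^+ (e + k))).
  rewrite divdiff_sum /complete_symmetric raddf_sum/=; apply: eq_bigr => e _.
  rewrite divdiffZ mevalZ; congr (_ * _); rewrite raddf_sum/=.
  under eq_bigr do rewrite rmorph_prod/=.
  have <- : [set x j | j : 'I_k.+1 & (0 <= j)%N] = [set x j | j : 'I_k.+1].
    apply/setP => y; apply/imsetP/imsetP => -[j _ ->];
      by exists j; rewrite ?inE.
  rewrite -(hsum_divdiff xI _ (i := 0))//; apply: eq_big => t.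
    by case: (map val t) => //= ? ?; rewrite leq0n.
  by move=> _; apply: eq_bigr => j _; rewrite mevalXU.
move=> y; rewrite hornerM hornerXn horner_sum mulr_sumr subn1.
apply: eq_bigr => e _; rewrite hornerZ hornerXn mulrCA exprD.
by rewrite [y ^+ e * _]mulrC.
Qed.

(** * The case of large k *)

Section RootCounting.
Variable F : finFieldType.
Implicit Types (T : {set F}) (P : {poly F}).

Lemma card_roots_lt P : P != 0 -> (#|[set x | root P x]| < size P)%N.
Proof.
move=> P0; rewrite cardE; apply: max_poly_roots => //; last exact: enum_uniq.
by apply/allP => x; rewrite mem_enum inE.
Qed.

Lemma exists_nonroot_notin T P : P != 0 -> (#|T| + size P <= #|F|)%N ->
  exists2 d, d \notin T & ~~ root P d.
Proof.
move=> P0 leF; have : T :|: [set x | root P x] != setT.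
  apply: contraTneq leF => eqT; rewrite -ltnNge -cardsT -eqT.
  apply: leq_ltn_trans (leq_card_setU _ _) _.
  by rewrite ltn_add2l card_roots_lt.
rewrite -subTset => /subsetPn[d _]; rewrite !inE negb_or => /andP[? ?].
by exists d.
Qed.

Lemma exists_notin T : (#|T| < #|F|)%N -> exists d, d \notin T.
Proof.
move=> ltF; have [||d dT _] := @exists_nonroot_notin T 1; last by exists d.
  exact: oner_neq0.
by rewrite size_poly1 addn1.
Qed.

(* Vanishing of the form means that b is the image of a under a homography,
   which is injective off few exceptional points when v^2 != u w; it would have
   to map most of the complement of T into T. *)
Lemma bilinear_form_trichotomy T (u v w : F) : ((#|T| + 2).*2 <= #|F|)%N ->
  (forall a b, a \notin T -> b \notin T -> a != b ->
    w - (a + b) * v + a * b * u != 0) ->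
  [\/ u = 0 /\ v = 0,
      [/\ u != 0, v ^+ 2 = u * w & exists2 c, c \in T & v = c * u] |
      [/\ 2%:R = 0 :> F, u = 0, v != 0 & w = 0]].
Proof.
move=> leF nzB.
have [/andP[/eqP u0 /eqP v0]|uv0] := boolP ((u == 0) && (v == 0)).
  by constructor 1.
have [eq_v2|ne_v2] := eqVneq (v ^+ 2) (u * w).
  have u0 : u != 0.
    apply: contraNneq uv0 => u0; rewrite u0 eqxx/=.
    by move: eq_v2; rewrite u0 mul0r => /eqP; rewrite expf_eq0.
  constructor 2; split=> //; exists (v / u); last by rewrite divfK.
  (* Here u times the form is (a u - v)(b u - v), which vanishes at a = v / u for every b. *)
  apply/negPn/negP => cT.
  have [|b] := @exists_notin (v / u |: T).
    by rewrite cardsU1 cT; lia.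
  rewrite !inE negb_or eq_sym => /andP[cb bT].
  have /negP[] := nzB _ _ cT bT cb.
  have -> : w = v ^+ 2 / u by rewrite eq_v2 mulrC mulKf.
  by apply/eqP; field.
(* The homography is a |-> (a v - w) / (a u - v): [P1] is its denominator, and the roots of [P2] are
   its fixed points. *)
pose P1 : {poly F} := u *: 'X - v%:P.
pose P2 : {poly F} := u *: 'X^2 - (2%:R * v) *: 'X + w%:P.
have [P10|P10] := eqVneq P1 0.
  case/negP: uv0; apply/andP.
  have := congr1 (fun P : {poly F} => P`_0) P10.
  have := congr1 (fun P : {poly F} => P`_1) P10.
  rewrite !coefE/= => /eqP; rewrite mulr1 subr0 => u0 /eqP.
  by rewrite mulr0 sub0r oppr_eq0.
have [P20|P20] := eqVneq P2 0.
  (* The homography is the identity, so the form vanishes only when a = b. *)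
  constructor 3.
  have := congr1 (fun P : {poly F} => P`_0) P20.
  have := congr1 (fun P : {poly F} => P`_1) P20.
  have := congr1 (fun P : {poly F} => P`_2) P20.
  rewrite !coefE/= !(mulr0, mulr1, subr0, sub0r, addr0, add0r, oppr0).
  move=> u0 /eqP; rewrite oppr_eq0 mulf_eq0 => v20 w0.
  have v0 : v != 0 by move: uv0; rewrite u0 eqxx.
  by split=> //; apply/eqP; move: v20; rewrite (negPf v0) orbF.
pose D := ~: (T :|: [set x | root (P1 * P2) x]).
have sP : (size (P1 * P2)%R <= 4)%N.
  apply: leq_trans (size_polyMleq _ _) _.
  have : (size P1 <= 2)%N.
    by apply/leq_sizeP => j; rewrite !coefE; case: j => [|[|j]]//=;
      rewrite mulr0 subr0.
  have : (size P2 <= 3)%N.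
    by apply/leq_sizeP => j; rewrite !coefE; case: j => [|[|[|j]]]//=;
      rewrite !mulr0 subr0 addr0.
  lia.
have cardD : (#|F| <= #|D| + #|T| + 3)%N.
  have := cardsC D; rewrite setCK => <-; rewrite -addnA leq_add2l.
  apply: leq_trans (leq_card_setU _ _) _; rewrite leq_add2l -ltnS.
  by apply: leq_trans (card_roots_lt _) sP; rewrite mulf_neq0.
pose b a := (a * v - w) / (a * u - v).
have Dden a : a \in D -> [/\ a \notin T, a * u - v != 0 &
    u * a ^+ 2 - 2%:R * v * a + w != 0].
  rewrite !inE negb_or rootM negb_or => /and3P[aT].
  by rewrite !rootE !hornerE/= [u * a]mulrC; split.
(* The homography injects D into T, which would give [#|F| <= 2 #|T| + 3]. *)
suff leDT : (#|D| <= #|T|)%N by move: leF cardD leDT; lia.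
have bI : {in D &, injective b}.
  move=> x y /Dden[_ x0 _] /Dden[_ y0 _] /eqP.
  rewrite eqr_div// -subr_eq0.
  have -> : (x * v - w) * (y * u - v) - (y * v - w) * (x * u - v) =
    (y - x) * (v ^+ 2 - u * w) by ring.
  by rewrite mulf_eq0 !subr_eq0 (negPf ne_v2) orbF eq_sym => /eqP.
rewrite -(card_in_imset bI).
apply/subset_leq_card/subsetP => _ /imsetP[x xD ->].
have [xT x0 x1] := Dden _ xD; apply/negPn/negP => bT.
have /negP[] : w - (x + b x) * v + x * b x * u != 0.
  apply: nzB => //; apply: contra x1 => /eqP xb; apply/eqP.
  have : x * (x * u - v) = x * v - w by rewrite {1}xb /b divfK.
  move=> /eqP; rewrite -subr_eq0 => /eqP <-; ring.
by apply/eqP; rewrite /b; field.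
Qed.
End RootCounting.

(** * A linear functional that is nonzero on products of r distinct linear factors *)

Section WeightedSums.
Variables (F : finFieldType) (g : F -> F).
Implicit Types (S T : {set F}) (P : {poly F}).

Definition weighted_sum P := \sum_x g x * P.[x].

Definition setpoly S : {poly F} := \prod_(s in S) ('X - s%:P).

Lemma horner_setpoly S x : (setpoly S).[x] = \prod_(s in S) (x - s).
Proof. by rewrite horner_prod; apply: eq_bigr => s _; rewrite hornerXsubC. Qed.

Lemma setpoly_monic S : setpoly S \is monic.
Proof. by rewrite /setpoly -big_enum monic_prod_XsubC. Qed.

Lemma size_setpoly S : size (setpoly S) = #|S|.+1.
Proof. by rewrite /setpoly -big_enum size_prod_XsubC cardE. Qed.

Lemma weighted_sum_mul_XsubC c P :
  weighted_sum (('X - c%:P) * P) = weighted_sum ('X * P) - c * weighted_sum P.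
Proof.
rewrite mulr_sumr -sumrB; apply: eq_bigr => x _.
by rewrite !(hornerM, hornerXsubC, hornerX); ring.
Qed.

Variable r : nat.
Hypotheses (r_gt1 : (1 < r)%N) (r_char2 : 2%:R = 0 :> F -> (2 < r)%N).
Hypothesis r_half : (r.*2 <= #|F|)%N.
Hypothesis nz_setpoly : forall S, #|S| = r -> weighted_sum (setpoly S) != 0.

Let mom i S := weighted_sum ('X^i * setpoly S).

Lemma mom_setU1 i c S : c \notin S ->
  mom i (c |: S) = mom i.+1 S - c * mom i S.
Proof.
move=> cS; rewrite /mom /setpoly big_setU1//= mulrCA weighted_sum_mul_XsubC.
by rewrite mulrA -exprS.
Qed.

(** With u, v, w the first three moments, the bilinear form is the functional at (X - a)(X - b)
    times [setpoly T]; it is nonzero because a, b and T make r distinct points. *)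
Lemma mom_trichotomy T : (#|T| + 2 = r)%N ->
  [\/ mom 0 T = 0 /\ mom 1 T = 0,
      [/\ mom 0 T != 0, mom 1 T ^+ 2 = mom 0 T * mom 2 T &
        exists2 c, c \in T & mom 1 T = c * mom 0 T] |
      [/\ 2%:R = 0 :> F, mom 0 T = 0, mom 1 T != 0 & mom 2 T = 0]].
Proof.
move=> cardT; apply: bilinear_form_trichotomy; rewrite ?cardT// => a b aT bT ab.
have abT : a \notin b |: T by rewrite !inE negb_or ab.
have := @nz_setpoly (a |: (b |: T)).
rewrite !cardsU1 abT bT -cardT !add1n addn2 => /(_ erefl).
rewrite -[setpoly _]mul1r -[1]/('X^0) -/(mom 0 _) !mom_setU1//.
by apply: contra => /eqP <-; apply/eqP; ring.
Qed.

(* Exchanging c for a generic d gives a set for which no case of the trichotomy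
   is possible; likewise in mom_char2_case. *)
Lemma mom_point_case T c : (#|T| + 2 = r)%N -> c \in T -> mom 0 T != 0 ->
  mom 1 T = c * mom 0 T -> mom 1 T ^+ 2 = mom 0 T * mom 2 T -> False.
Proof.
move=> cardT cT u0 v_u v2.
have w_u : mom 2 T = c ^+ 2 * mom 0 T.
  by apply: (mulfI u0); rewrite -v2 v_u; ring.
have cT' : c \notin T :\ c by rewrite !inE eqxx.
have cardT' : #|T| = #|T :\ c|.+1 by rewrite (cardsD1 c T) cT.
move: u0 v_u w_u; rewrite -(setD1K cT) !mom_setU1//.
set m0 := mom 0 _; set m1 := mom 1 _; set m2 := mom 2 _; set m3 := mom 3 _.
set u := m1 - _ => u0 v_u w_u.
have m1E : m1 = c * m0 + u by rewrite /u; ring.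
have m2E : m2 = c * m1 + c * u by rewrite -v_u; ring.
have m3E : m3 = c * m2 + c ^+ 2 * u by rewrite -w_u; ring.
(* The value of [P] at d is [mom 0 (d |: (T :\ c))], so a non-root d excludes the third case. *)
pose P : {poly F} := (c * m0 + u)%:P - m0 *: 'X.
have [||d] := @exists_nonroot_notin F (c |: (T :\ c)) P.
- apply: contraNneq u0 => P0.
  have := congr1 (fun P : {poly F} => P`_0) P0.
  have := congr1 (fun P : {poly F} => P`_1) P0.
  rewrite !coefE/= !(mulr0, mulr1, subr0, sub0r) => /eqP.
  by rewrite oppr_eq0 => /eqP ->; rewrite mulr0 add0r => /eqP.
- have : (size P <= 2)%N.
    by apply/leq_sizeP => j; rewrite !coefE; case: j => [|[|j]]//=;
      rewrite mulr0 subr0.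
  by rewrite setD1K//; move: cardT r_half; lia.
rewrite in_setU1 negb_or => /andP[dc dT].
rewrite rootE /P !hornerE/= => Pd.
have cd0 : c - d != 0 by rewrite subr_eq0 eq_sym.
have uE : mom 0 (d |: (T :\ c)) = (c - d) * m0 + u.
  by rewrite mom_setU1// -/m0 -/m1 m1E; ring.
have vE : mom 1 (d |: (T :\ c)) = (c - d) * m1 + c * u.
  by rewrite mom_setU1// -/m1 -/m2 m2E; ring.
have wE : mom 2 (d |: (T :\ c)) = (c - d) * m2 + c ^+ 2 * u.
  by rewrite mom_setU1// -/m2 -/m3 m3E; ring.
case: (@mom_trichotomy (d |: (T :\ c))); first by rewrite cardsU1 dT; lia.
- rewrite uE vE => -[e0 e1]; case/negP: (mulf_neq0 cd0 u0); apply/eqP.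
  have -> : (c - d) * u = ((c - d) * m1 + c * u) - c * ((c - d) * m0 + u).
    by rewrite m1E; ring.
  by rewrite e0 e1; ring.
- case=> _ e _; have /negP[] : ((c - d) * u) ^+ 2 != 0.
    by rewrite expf_neq0// mulf_neq0.
  apply/eqP; move: e; rewrite uE vE wE => /eqP.
  by rewrite -subr_eq0 => /eqP <-; rewrite m2E m1E; ring.
- case=> _ e _ _; case/negP: Pd; apply/eqP; by rewrite -e uE /u; ring.
Qed.

Lemma mom_char2_case T : (#|T| + 2 = r)%N -> 2%:R = 0 :> F ->
  mom 0 T = 0 -> mom 1 T != 0 -> mom 2 T = 0 -> False.
Proof.
move=> cardT two0 u0 v0 w0.
(* The exchange needs a point in T, hence r > 2 in characteristic 2. *)
have /card_gt0P[c cT] : (0 < #|T|)%N by have := r_char2 two0; lia.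
have cT' : c \notin T :\ c by rewrite !inE eqxx.
have cardT' : #|T| = #|T :\ c|.+1 by rewrite (cardsD1 c T) cT.
move: u0 v0 w0; rewrite -(setD1K cT) !mom_setU1//.
set m0 := mom 0 _; set m1 := mom 1 _; set m2 := mom 2 _; set m3 := mom 3 _.
set v := m2 - _ => u0 v0 w0.
have m1E : m1 = c * m0 by apply/eqP; rewrite -subr_eq0 u0.
have m2E : m2 = c * m1 + v by rewrite /v; ring.
have m3E : m3 = c * m2 by apply/eqP; rewrite -subr_eq0 w0.
(* In characteristic 2 this is m0 (X - c)^2 - v, and the second case would make d a root. *)
pose P : {poly F} := m0 *: 'X^2 + (c ^+ 2 * m0 - v)%:P.
have P_le : (size P <= 3)%N.
  by apply/leq_sizeP => j; rewrite !coefE; case: j => [|[|[|j]]]//=;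
    rewrite mulr0 addr0.
have [||d] := @exists_nonroot_notin F (c |: (T :\ c)) P.
- apply: contraNneq v0 => P0.
  have := congr1 (fun P : {poly F} => P`_0) P0.
  have := congr1 (fun P : {poly F} => P`_2) P0.
  rewrite !coefE/= !(mulr0, mulr1, addr0, add0r) => ->.
  by rewrite mulr0 sub0r => /eqP; rewrite oppr_eq0.
- by rewrite setD1K//; move: cardT r_half (r_char2 two0); lia.
rewrite in_setU1 negb_or => /andP[dc dT].
rewrite rootE /P !hornerE/= => Pd.
have cd0 : c - d != 0 by rewrite subr_eq0 eq_sym.
have uE : mom 0 (d |: (T :\ c)) = (c - d) * m0.
  by rewrite mom_setU1// -/m0 -/m1 m1E; ring.
have vE : mom 1 (d |: (T :\ c)) = (c - d) * m1 + v.
  by rewrite mom_setU1// -/m1 -/m2 m2E; ring.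
have wE : mom 2 (d |: (T :\ c)) = (c - d) * m2.
  by rewrite mom_setU1// -/m2 -/m3 m3E; ring.
case: (@mom_trichotomy (d |: (T :\ c))); first by rewrite cardsU1 dT; lia.
- rewrite uE vE => -[e0 e1]; case/negP: v0; apply/eqP.
  have -> : v = ((c - d) * m1 + v) - c * ((c - d) * m0) by rewrite m1E; ring.
  by rewrite e0 e1; ring.
- case=> _ e _; move: e; rewrite uE vE wE => /eqP.
  have -> : ((c - d) * m1 + v) ^+ 2 = (c - d) * m0 * ((c - d) * m2) +
      v * (v - (c - d) ^+ 2 * m0 + 2%:R * (c - d) * m1).
    by rewrite m2E m1E; ring.
  rewrite two0 mul0r mul0r addr0 -subr_eq0 addrC addKr mulf_eq0 (negPf v0)/=.
  move=> /eqP e.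
  case/negP: Pd; apply/eqP.
  transitivity (2%:R * (c * d * m0) - (v - (c - d) ^+ 2 * m0)).
    by rewrite /v; ring.
  by rewrite e two0; ring.
- case=> _ e0 _ e2; case/negP: (mulf_neq0 cd0 v0); apply/eqP.
  have -> : (c - d) * v = (c - d) * m2 - c ^+ 2 * ((c - d) * m0).
    by rewrite m2E m1E; ring.
  by rewrite -uE -wE e0 e2; ring.
Qed.

(** If S is T with a point c added, the sum is [mom 1 T - c * mom 0 T], and only the case where both
    moments vanish survives. *)
Lemma weighted_sum_setpoly_eq0 S : (#|S| + 1 = r)%N ->
  weighted_sum (setpoly S) = 0.
Proof.
move=> cardS; have /card_gt0P[c cS] : (0 < #|S|)%N by lia.
have cS' : c \notin S :\ c by rewrite !inE eqxx.
have cardS' : #|S| = #|S :\ c|.+1 by rewrite (cardsD1 c S) cS.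
have cardT : (#|S :\ c| + 2 = r)%N by lia.
rewrite -[setpoly _]mul1r -[1]/('X^0) -/(mom 0 _) -(setD1K cS) mom_setU1//.
case: (mom_trichotomy cardT) => [[-> ->]|[u0 v2 [d dT vE]]|[two0 u0 v0 w0]].
- by rewrite mulr0 subr0.
- by case: (mom_point_case cardT dT).
- by case: (mom_char2_case cardT).
Qed.

End WeightedSums.

(** * The case of small k *)

Section SetInclusion.
Variables (R : idomainType) (T : finType) (m : nat) (U : {set T}).
Variable Y : {set T} -> R.
Hypothesis natr_neq0 : forall i, (0 < i <= m.+1)%N -> i%:R != 0 :> R.
Hypothesis sumY0 : forall A : {set T}, A \subset U -> #|A| = m ->
  \sum_(e in U :\: A) Y (e |: A) = 0.

(* Summing the hypotheses over the m-sets A containing I counts each B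
   containing I exactly m + 1 - #|I| times, whence between I set0 = 0; then
   inclusion-exclusion on J isolates B as the only set avoiding U :\: B. *)
Let between (I J : {set T}) :=
  \sum_(B : {set T} | [&& B \subset U, #|B| == m.+1, I \subset B
    & J \subset ~: B]) Y B.

Lemma between_set0 (I : {set T}) :
  I \subset U -> (#|I| <= m)%N -> between I set0 = 0.
Proof.
move=> IU leIm.
pose P n (B : {set T}) := [&& B \subset U, #|B| == n & I \subset B].
have -> : between I set0 = \sum_(B | P m.+1 B) Y B.
  apply: eq_bigl => B; congr [&& _, _ & _].
  by rewrite sub0set andbT.
(* Double counting: a pair (A, e) with e outside A is the same as a pair (B, e) with e in [B :\: I],
   where [B = e |: A]. *)
have step e : e \in U -> \sum_(A | P m A && (e \in U :\: A)) Y (e |: A) =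
    \sum_(B | P m.+1 B && (e \in B :\: I)) Y B.
  move=> eU.
  rewrite (reindex_onto (fun B => B :\ e) (fun A => e |: A)); last first.
    by move=> A /andP[_]; rewrite inE => /andP[eA _]; rewrite setU1K.
  apply: eq_big => [B|B /andP[_ /eqP ->]//].
  rewrite /P !inE eqxx eU !andbT.
  have [eB|eB] := boolP (e \in B); last first.
    rewrite !andbF; apply/negP => /andP[_ /eqP eqB].
    by move: eB; rewrite -eqB !inE eqxx.
  have BU : (B \subset U) = (B :\ e \subset U).
    by rewrite -{1}(setD1K eB) subUset sub1set eU.
  rewrite setD1K// eqxx !andbT (cardsD1 e B) eB eqSS subsetD1 BU.
  by rewrite -!andbA.
have : \sum_(A | P m A) \sum_(e in U :\: A) Y (e |: A) = 0.
  by rewrite big1// => A /and3P[AU /eqP cardA _]; apply: sumY0.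
rewrite (exchange_big_dep (mem U))/=; last by move=> A e _ /setDP[].
rewrite (eq_bigr _ step) (exchange_big_dep (P m.+1))/=; last first.
  by move=> e B _ /andP[].
rewrite (eq_bigr (fun B => Y B *+ (m.+1 - #|I|))); last first.
  move=> B PB; have /and3P[BU /eqP cardB IB] := PB.
  rewrite -[m.+1]cardB -(cardsDS IB) -sumr_const; apply: eq_bigl => e.
  rewrite /P BU IB eqxx /=.
  have [eBI|] := boolP (e \in B :\: I); last by rewrite andbF.
  by have /setDP[/(subsetP BU) -> _] := eBI.
rewrite sumrMnl -mulr_natr => /eqP; rewrite mulf_eq0 (negPf (natr_neq0 _)).
  by rewrite orbF => /eqP.
by rewrite subn_gt0 ltnS leIm leq_subr.
Qed.

Lemma between_eq0 n (I J : {set T}) : I \subset U -> J \subset U ->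
  #|J| = n -> (#|I| + n <= m)%N -> between I J = 0.
Proof.
elim: n I J => [|n IHn] I J IU JU cardJ leIJ.
  by rewrite (cards0_eq cardJ) between_set0// -(addn0 #|I|).
have /card_gt0P[j jJ] : (0 < #|J|)%N by rewrite cardJ.
have jU : j \in U by apply: subsetP jJ.
have cardJ' : #|J :\ j| = n.
  by apply/eqP; rewrite -eqSS -cardJ (cardsD1 j J) jJ.
have J'U : J :\ j \subset U by rewrite (subset_trans _ JU)// subsetDl.
have : between I (J :\ j) = between (j |: I) (J :\ j) + between I J.
  rewrite /between (bigID (fun B : {set T} => j \in B))/=.
  congr (_ + _); apply: eq_bigl => B; rewrite -!andbA; congr [&& _, _ & _].
    by rewrite subUset sub1set -[in RHS]andbA [RHS]andbC -andbA.
  rewrite -[in RHS](setD1K jJ) subUset sub1set in_setC.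
  by rewrite [X in _ = _ && X]andbC.
rewrite (IHn I) ?(IHn (j |: I)) ?add0r//; last by lia.
  by rewrite subUset sub1set jU.
by rewrite cardsU1; case: (j \notin I); lia.
Qed.

Lemma inclusion_injective (B : {set T}) : #|U| = m.*2.+1 ->
  B \subset U -> #|B| = m.+1 -> Y B = 0.
Proof.
move=> cardU BU cardB.
(* [U :\: B] has m points, exactly the most that [between_eq0] allows. *)
have := @between_eq0 m set0 (U :\: B) (sub0set _) (subsetDl _ _).
rewrite cardsDS// cards0 add0n => <- //; last by lia.
rewrite /between (big_pred1 B)// => C; rewrite sub0set/=.
apply/idP/eqP => [/and3P[CU /eqP cardC dis]|->]; last first.
  by rewrite BU cardB eqxx subDset setUCr subsetT.
apply/eqP; rewrite eqEcard cardB cardC leqnn andbT; apply/subsetP => x xC.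
apply/negPn/negP => xB; have := subsetP dis x.
by rewrite !inE xC xB (subsetP CU)// => /(_ isT).
Qed.

End SetInclusion.

Lemma imset_setD1 (aT rT : finType) (f : aT -> rT) (C : {set aT}) x :
  {in C &, injective f} -> x \in C -> f @: C :\ f x = f @: (C :\ x).
Proof.
move=> fI xC; apply/setP => y; rewrite !inE; apply/andP/imsetP.
  case=> yx /imsetP[z zC def_y]; exists z => //.
  by rewrite in_setD1 zC andbT; apply: contraNneq yx => <-; rewrite def_y.
case=> z /setD1P[zx zC] ->; split; last exact: imset_f.
by apply: contra zx => /eqP /fI ->.
Qed.

Lemma exists_subset_card (T : finType) (S : {set T}) n : (n <= #|S|)%N ->
  exists2 Z : {set T}, Z \subset S & #|Z| = n.
Proof.
case/card_geqP => s [s_uniq <- sS]; exists [set x in s].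
  by apply/subsetP => x; rewrite inE => /sS.
by rewrite cardsE; apply/card_uniqP.
Qed.

(** * Divided differences over a set in terms of products over its complement *)

Section Complement.
Variable F : finFieldType.
Implicit Types (C : {set F}).

(** As y runs over all points but x, x - y runs over all nonzero elements. *)
Lemma prod_subr_compl (x : F) C : x \in C ->
  \prod_(y in C :\ x) (x - y) * \prod_(y in ~: C) (x - y) =
    \prod_(z : F | z != 0) z.
Proof.
move=> xC; rewrite [RHS](reindex_inj (inv_inj (subKr x)))/=.
rewrite [RHS](bigID (mem C))/=; congr (_ * _); apply: eq_bigl => y.
  by rewrite !inE subr_eq0 eq_sym.
rewrite !inE subr_eq0 andb_idl// => yC.
by apply: contraNneq yC => <-.
Qed.

(** The polynomial [setpoly (~: C)] vanishes off C, and on C [prod_subr_compl] turns its value into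
    the inverse of the denominator, up to the constant. *)
Lemma divdiff_weighted_sum (g : F -> F) C :
  (\prod_(z : F | z != 0) z) * divdiff g C = weighted_sum g (setpoly (~: C)).
Proof.
rewrite mulr_sumr /weighted_sum [RHS](bigID (mem C))/=.
rewrite [X in _ = _ + X]big1 ?addr0.
  apply: eq_bigr => x xC; rewrite horner_setpoly -(prod_subr_compl xC).
  have : \prod_(y in C :\ x) (x - y) != 0.
    by apply: prod_subr_neq0; rewrite !inE eqxx.
  by move=> P0; field.
move=> x xC; rewrite horner_setpoly (big_setD1 x)/= ?inE ?xC//.
by rewrite subrr mul0r mulr0.
Qed.

End Complement.

(** * The Segre-Ball argument for divided differences *)

Section SmallOrder.
Variables (F : finFieldType) (g : F -> F) (m : nat).
Implicit Types (A B C E U Z : {set F}).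
Hypothesis natr_neq0 : forall i, (0 < i <= m.+1)%N -> i%:R != 0 :> F.
Hypothesis nz_divdiff : forall C, #|C| = m.+2 -> divdiff g C != 0.

Lemma divdiff_sub A x y : x \notin A -> y \notin A -> x != y ->
  divdiff g (x |: A) - divdiff g (y |: A) = (x - y) * divdiff g (y |: (x |: A)).
Proof.
move=> xA yA xy; have yxA : y \notin x |: A by rewrite !inE negb_or eq_sym xy.
have xyA : x \notin y |: A by rewrite !inE negb_or xy.
rewrite (@divdiff_rec _ g x y) ?inE ?eqxx ?orbT//.
by rewrite setU1K// setUCA setU1K.
Qed.

Lemma divdiff_setU1_inj A : #|A| = m ->
  {in ~: A &, injective (fun x => divdiff g (x |: A))}.
Proof.
move=> cardA x y; rewrite !inE => xA yA /eqP; apply: contraTeq => xy.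
rewrite -subr_eq0 divdiff_sub// mulf_neq0 ?subr_eq0// nz_divdiff//.
by rewrite !cardsU1 !inE negb_or eq_sym xy xA yA cardA.
Qed.

Definition outer_prod B := \prod_(x in ~: B) divdiff g (x |: B).

Lemma outer_prod_neq0 B : #|B| = m.+1 -> outer_prod B != 0.
Proof.
move=> cardB; apply/prodf_neq0 => x; rewrite inE => xB.
by rewrite nz_divdiff// cardsU1 xB cardB.
Qed.

(* The roots of P are the values missed by x |-> divdiff g (x |: A); the
   symmetry of outer_prod (b |: A) is Segre's lemma of tangents. *)
Lemma tangent_poly A : #|A| = m -> exists2 P : {poly F},
  P \is monic /\ size P = m.+1 &
  forall b, b \notin A ->
    P.[divdiff g (b |: A)] * outer_prod (b |: A) = \prod_(a in A) (b - a).
Proof.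
move=> cardA; pose ph x := divdiff g (x |: A).
have phI := divdiff_setU1_inj cardA; rewrite -/ph in phI.
pose C := ph @: ~: A.
have cardC : #|~: C| = m.
  have eqC : #|C| = #|~: A| by apply: card_in_imset.
  by apply/eqP; rewrite -(eqn_add2l #|C|) cardsC eqC -cardA addnC cardsC.
exists (setpoly (~: C)).
  by rewrite setpoly_monic size_setpoly cardC.
move=> b bA; have bA' : b \in ~: A by rewrite inE.
have phbC : ph b \in C by apply: imset_f.
(* The product of the nonzero elements is factored twice, around [ph b] and around b. The
   differences of values are differences of points times divided differences, and the latter
   multiply to [outer_prod (b |: A)]. *)
rewrite horner_setpoly; have := prod_subr_compl phbC.
rewrite -(prod_subr_compl bA') setCK.
have DA : ~: A :\ b = ~: (b |: A) by rewrite setCU setIC setDE.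
rewrite imset_setD1// big_imset/=; last first.
  by move=> x y /setD1P[_ xA] /setD1P[_ yA]; apply: phI.
rewrite (eq_bigr (fun x => (b - x) * divdiff g (x |: (b |: A)))); last first.
  move=> x /setD1P[xb xA]; apply: divdiff_sub => //; last by rewrite eq_sym.
  by move: xA; rewrite inE.
rewrite big_split/= {2}DA -/(outer_prod _) -mulrA => eqw.
have: \prod_(x in ~: A :\ b) (b - x) != 0.
  by apply: prod_subr_neq0; rewrite !inE eqxx.
by move/mulfI; apply; rewrite -eqw [_ * outer_prod _]mulrC.
Qed.

(** For g = x^(m+1) every divided difference over m + 2 points is 1, and so is this quantity;
    [ratio_eq1] extends this to g. *)
Let ratio U B :=
  (outer_prod B * \prod_(z in U :\: B) divdiff g (z |: B))^-1.

(** This is Lagrange interpolation of the leading coefficient of the polynomial of [tangent_poly] at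
    the m + 1 values [divdiff g (e |: A)]. *)
Lemma sum_ratio A E : #|A| = m -> #|E| = m.+1 -> [disjoint A & E] ->
  \sum_(e in E) (\prod_(a in A) (e - a) / \prod_(z in E :\ e) (e - z))
    * ratio (A :|: E) (e |: A) = 1.
Proof.
move=> cardA cardE dis.
have EA e : e \in E -> e \notin A by move=> eE; rewrite (disjointFl dis eE).
have phI := divdiff_setU1_inj cardA; pose ph x := divdiff g (x |: A).
rewrite -/ph in phI.
have phIE : {in E &, injective ph}.
  by move=> x y xE yE; apply: phI; rewrite inE EA.
have [P [Pmonic sP] PE] := tangent_poly cardA.
have cardphE : #|ph @: E| = m.+1 by rewrite card_in_imset.
have := @divdiff_horner _ P (ph @: E); rewrite cardphE sP => /(_ (leqnn _)).
have -> : P`_m.+1.-1 = 1 by rewrite -[m.+1]sP -lead_coefE; apply/monicP.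
move=> sum1; rewrite -[RHS]sum1 /divdiff big_imset//=; apply: eq_bigr => e eE.
rewrite imset_setD1// big_imset/=; last first.
  by move=> x y /setD1P[_ xA] /setD1P[_ yA]; apply: phIE.
rewrite [X in _ = _ / X](eq_bigr (fun x =>
    (e - x) * divdiff g (x |: (e |: A)))); last first.
  by move=> x /setD1P[xb xA]; apply: divdiff_sub; rewrite ?EA// eq_sym.
rewrite big_split/=.
rewrite -(PE _ (EA _ eE)) /ratio.
have -> : (A :|: E) :\: (e |: A) = E :\ e.
  apply/setP => x; rewrite !inE negb_or; have := EA x.
  case: (x \in E) => [/(_ isT) /negPf ->|_]; first by rewrite !andbT.
  by rewrite orbF andbF -andbA andNb andbF.
rewrite !invfM -!mulrA; congr (_ * _); rewrite mulrCA mulVKf//.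
by rewrite outer_prod_neq0// cardsU1 EA// cardA.
Qed.

(** The constant 1 solves the same system as [ratio U]. Dividing their difference by [kappa] makes
    all coefficients of an equation equal, so [inclusion_injective] applies. *)
Lemma ratio_eq1 U B : #|U| = m.*2.+1 -> B \subset U -> #|B| = m.+1 ->
  ratio U B = 1.
Proof.
move=> cardU BU cardB.
pose kappa B := \prod_(b in B) \prod_(z in U :\: B) (b - z).
have kappa_neq0 B' : kappa B' != 0.
  apply/prodf_neq0 => b bB; apply: prod_subr_neq0.
  by rewrite inE bB.
pose Y B := (ratio U B - 1) / kappa B.
suff Y0 : Y B = 0.
  move/eqP: Y0; rewrite /Y mulf_eq0 invr_eq0 (negPf (kappa_neq0 B)) orbF.
  by rewrite subr_eq0 => /eqP.
apply: (@inclusion_injective _ _ m U) => // A AU cardA.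
pose E := U :\: A.
have dis : [disjoint A & E].
  by apply/pred0P => x /=; rewrite !inE; case: (x \in A).
have AE : A :|: E = U.
  apply/setP => x; rewrite !inE orbC; have [xA|_] := boolP (x \in A).
    by rewrite orbT (subsetP AU).
  by rewrite orbF.
have cardE : #|E| = m.+1 by rewrite cardsDS// cardU cardA; lia.
have EA e : e \in E -> e \notin A by move=> eE; rewrite (disjointFl dis eE).
pose c e := \prod_(a in A) (e - a) / \prod_(z in E :\ e) (e - z).
(* K does not depend on e; its sign turns the m factors a - e into e - a. *)
pose K := (-1) ^+ m / \prod_(a in A) \prod_(z in E) (a - z).
have kappaE e : e \in E -> (kappa (e |: A))^-1 = K * c e.
  move=> eE; rewrite /kappa big_setU1 ?EA//=.
  have -> : U :\: (e |: A) = E :\ e by rewrite setUC setDDl.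
  rewrite /K /c.
  rewrite [X in _ / X * _](eq_bigr (fun a =>
      - (e - a) * \prod_(z in E :\ e) (a - z)));
    last by move=> a aA; rewrite (big_setD1 e)//= opprB.
  rewrite big_split/= prodrN cardA.
  have s0 : (-1) ^+ m != 0 :> F by rewrite expf_neq0// oppr_eq0 oner_eq0.
  have P1 : \prod_(a in A) (e - a) != 0 by apply: prod_subr_neq0; apply: EA.
  have P2 : \prod_(z in E :\ e) (e - z) != 0.
    by apply: prod_subr_neq0; rewrite !inE eqxx.
  have P3 : \prod_(a in A) \prod_(z in E :\ e) (a - z) != 0.
    apply/prodf_neq0 => a aA; apply: prod_subr_neq0.
    by rewrite !inE aA andbF.
  by field; rewrite ?s0 ?P1 ?P2 ?P3.
transitivity (K * (\sum_(e in E) c e * ratio U (e |: A) - \sum_(e in E) c e)).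
  rewrite -sumrB mulr_sumr; apply: eq_bigr => e eE.
  by rewrite /Y kappaE//; ring.
rewrite -{1}AE sum_ratio//.
(* The weights sum to 1, by interpolating the monic [setpoly A] on E itself. *)
have := @divdiff_horner _ (setpoly A) E.
rewrite cardE size_setpoly cardA => /(_ (leqnn _)).
have -> : (setpoly A)`_m.+1.-1 = 1.
  by rewrite -cardA -[_.+1]size_setpoly -lead_coefE; apply/monicP/setpoly_monic.
rewrite /divdiff; under eq_bigr do rewrite horner_setpoly.
by move=> ->; rewrite subrr mulr0.
Qed.

(* Both x and y are completed to an m-subset of the complement of B by a common
   set Z. *)
Lemma divdiff_setU1_eq B x y : (m.*2.+2 <= #|F|)%N -> (0 < m)%N ->
  #|B| = m.+1 -> x \notin B -> y \notin B ->
  divdiff g (x |: B) = divdiff g (y |: B).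
Proof.
move=> leF m_gt0 cardB xB yB.
(* With x or y added, Z has m points, so that its union with B has 2m + 1. Room for Z takes (m + 3)
   + (m - 1) = 2m + 2 points. *)
have [|Z ZS cardZ] := @exists_subset_card _ (~: (x |: (y |: B))) m.-1.
  rewrite -(leq_add2l #|x |: (y |: B)|) cardsC !cardsU1 cardB.
  apply: leq_trans leF.
  by case: (x \notin _); case: (y \notin B); lia.
have ZE z : z \in Z -> [/\ z != x, z != y & z \notin B].
  by move/(subsetP ZS); rewrite !inE !negb_or => /and3P[].
have key t : t \notin B -> t \notin Z ->
    outer_prod B * (divdiff g (t |: B) * \prod_(z in Z) divdiff g (z |: B)) = 1.
  move=> tB tZ; have tZB : (t |: Z) :&: B = set0.
    apply/setP => z; rewrite !inE; apply/negP => /andP[/orP[/eqP->|]].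
      exact/negP.
    by move=> /ZE[_ _ /negP].
  have := @ratio_eq1 (B :|: (t |: Z)) B; rewrite /ratio setDUl setDv set0U.
  have -> : (t |: Z) :\: B = t |: Z by apply/setDidPl; rewrite -setI_eq0 tZB.
  rewrite big_setU1// subsetUl cardsU setIC tZB cards0 cardsU1 tZ cardB cardZ.
  move=> /(_ _ isT erefl) ratio1; rewrite -[LHS]invrK ratio1 ?invr1//; lia.
have xZ : x \notin Z by apply/negP => /ZE[]; rewrite eqxx.
have yZ : y \notin Z by apply/negP => /ZE[_]; rewrite eqxx.
have := etrans (key x xB xZ) (esym (key y yB yZ)).
move/(mulfI (outer_prod_neq0 cardB)); apply: mulIf.
by apply/prodf_neq0 => z /ZE[_ _ zB]; rewrite nz_divdiff// cardsU1 zB cardB.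
Qed.

End SmallOrder.

(** * Vanishing of the divided differences over k + 1 points *)

Section NextOrder.
Variables (F : finFieldType) (g : F -> F) (k : nat).
Implicit Types C : {set F}.
Hypothesis nz_divdiff : forall C, #|C| = k -> divdiff g C != 0.

(** With [r = #|F| - k], complements of k-sets have r points and the complement of C has r - 1; the
    three bounds become 2r <= q, r > 1, and r > 2 in characteristic 2. *)
Lemma divdiff_next_eq0_large C : (#|F| <= k.*2)%N -> (k + 2 <= #|F|)%N ->
  (2%:R = 0 :> F -> (k + 3 <= #|F|)%N) -> #|C| = k.+1 -> divdiff g C = 0.
Proof.
move=> leF2k le_kF char2 cardC.
have w0 : \prod_(z : F | z != 0) z != 0 by apply/prodf_neq0.
apply: (mulfI w0); rewrite mulr0 divdiff_weighted_sum.
have cardCC (S : {set F}) : (#|~: S| = #|F| - #|S|)%N.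
  have <- : (#|S| + #|~: S| = #|F|)%N := cardsC S.
  by rewrite addKn.
apply: (@weighted_sum_setpoly_eq0 _ g (#|F| - k)%N); rewrite ?cardCC; try lia.
  by move/char2; lia.
move=> S cardS; rewrite -[S]setCK -divdiff_weighted_sum mulf_neq0//.
by rewrite nz_divdiff// cardCC cardS; lia.
Qed.

(** By [divdiff_setU1_eq] with m = k - 2, removing x or y from C gives the same divided difference,
    so [divdiff_rec] gives 0. *)
Lemma divdiff_next_eq0_small p C : p \in [pchar F] -> (k <= p)%N ->
  (2 < k)%N -> (k.*2 <= #|F| + 2)%N -> #|C| = k.+1 -> divdiff g C = 0.
Proof.
move=> pF le_kp k_gt2 leF cardC.
have /card_gt1P[x [y [xC yC xy]]] : (1 < #|C|)%N by rewrite cardC; lia.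
have def_k : k = (k - 2).+2 by lia.
have xyC : x \in C :\ y by rewrite !inE xy.
have yxC : y \in C :\ x by rewrite !inE eq_sym xy.
have cardB : #|C :\ y :\ x| = (k - 2).+1.
  by have := cardC; rewrite (cardsD1 y) yC (cardsD1 x) xyC; lia.
apply/eqP; have := divdiff_rec g xC yC.
have -> : C :\ y = x |: (C :\ y :\ x) by rewrite setD1K.
have -> : C :\ x = y |: (C :\ y :\ x).
  have -> : C :\ y :\ x = C :\ x :\ y by rewrite !setDDl setUC.
  by rewrite setD1K.
rewrite (@divdiff_setU1_eq _ g (k - 2)%N _ _ _ x y)//; try lia.
- by rewrite subrr => /eqP; rewrite mulf_eq0 subr_eq0 (negPf xy).
(* Here i is at most m + 1 = k - 1 < p. *)
- move=> i i_bound; rewrite -(dvdn_pcharf pF); apply/negP => /dvdn_leq; lia.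
- by move=> S; rewrite -def_k; apply: nz_divdiff.
- by rewrite !inE eqxx.
- by rewrite !inE eqxx andbF.
Qed.

End NextOrder.

(** The vanishing passes to larger sets by [divdiff_rec]; over [size P] nodes the divided difference
    is the leading coefficient. *)
Lemma divdiff_eq0_size (F : finFieldType) (P : {poly F}) k :
  (size P <= #|F|)%N ->
  (forall C : {set F}, #|C| = k.+1 -> divdiff (horner P) C = 0) ->
  (size P <= k)%N.
Proof.
move=> sP dd0; rewrite leqNgt; apply/negP => lt_kP.
have dd0' n (C : {set F}) : #|C| = (n + k.+1)%N -> divdiff (horner P) C = 0.
  elim: n C => [|n IHn] C cardC; first exact: dd0.
  have /card_gt1P[x [y [xC yC xy]]] : (1 < #|C|)%N by rewrite cardC; lia.
  apply/eqP; have := divdiff_rec (horner P) xC yC.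
  have cardCD z : z \in C -> #|C :\ z| = (n + k.+1)%N.
    by move=> zC; have := cardsD1 z C; rewrite zC cardC; lia.
  rewrite !(IHn (C :\ _)) ?cardCD// subrr => /eqP.
  by rewrite mulf_eq0 subr_eq0 (negPf xy).
have [|S _ cardS] := @exists_subset_card F setT (size P).
  by rewrite cardsT.
have := divdiff_horner (eq_leq (esym cardS)).
rewrite (dd0' (size P - k.+1)%N) ?subnK//.
rewrite cardS => /esym/eqP; rewrite -lead_coefE lead_coef_eq0 => /eqP P0.
by move: lt_kP; rewrite P0 size_poly0.
Qed.

(** * Reduction to divided differences *)

Section Reduction.
Variables (F : finFieldType) (P : {poly F}).

Lemma horner_reduction x : (reduction P).[x] = P.[x].
Proof.
rewrite {2}(divp_eq P ('X^#|F| - 'X)) hornerD hornerM hornerD hornerN.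
by rewrite hornerXn hornerX expf_card subrr mulr0 add0r.
Qed.

Lemma size_reduction : (size (reduction P) <= #|F|)%N.
Proof.
have sD : size ('X^#|F| - 'X : {poly F}) = #|F|.+1.
  by rewrite finField_genPoly -big_enum size_prod_XsubC -cardE cardT.
rewrite -ltnS -sD ltn_modp -size_poly_gt0 sD//.
Qed.

End Reduction.

Lemma Nstar_gt0 (F : finFieldType) k m (a : nat -> F) : (0 < k)%N ->
  (0 < Nstar (complete_symmetric k m a))%N <->
  exists2 C : {set F}, #|C| = k &
    divdiff (horner (reduction ('X^(k - 1) * \sum_(e < m.+1) a e *: 'X^e)))
      C = 0.
Proof.
move=> k_gt0; rewrite /Nstar card_gt0; split.
  case/set0Pn => x; rewrite inE => /andP[/eqP h0 /forallP x_inj].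
  have xI : injective x.
    move=> i j; move/forallP: (x_inj i) => /(_ j) /implyP xij xE.
    by apply/eqP/negPn/negP => /xij; rewrite xE eqxx.
  exists [set x j | j : 'I_k]; first by rewrite card_imset// card_ord.
  by rewrite (eq_divdiff _ (horner_reduction _)) -meval_complete_symmetric.
case=> C cardC; rewrite (eq_divdiff _ (horner_reduction _)) => dd0.
pose x := [ffun i : 'I_k => nth 0 (enum C) i].
have sC : size (enum C) = k by rewrite -cardE.
have xI : injective x.
  move=> i j; rewrite !ffunE => /eqP.
  by rewrite nth_uniq ?enum_uniq ?sC ?ltn_ord// => /eqP/val_inj.
apply/set0Pn; exists x; rewrite inE meval_complete_symmetric//.
have -> : [set x j | j : 'I_k] = C.
  apply/setP => y; apply/imsetP/idP => [[i _ ->]|yC].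
    by rewrite ffunE -mem_enum mem_nth// sC.
  have iC : (index y (enum C) < k)%N by rewrite -sC index_mem mem_enum.
  by exists (Ordinal iC) => //; rewrite ffunE nth_index// mem_enum.
rewrite dd0 eqxx/=; apply/forallP => i; apply/forallP => j; apply/implyP.
by apply: contra => /eqP/xI ->.
Qed.

(** Translating the sum of all elements by 1 shows that q = 0 in F; with q odd and 2 = 0 this would
    read 1 = 0. *)
Lemma odd_card_char_neq2 (F : finFieldType) : odd #|F| -> 2%:R != 0 :> F.
Proof.
move=> oddF; have : #|F|%:R = 0 :> F.
  apply: (addrI (\sum_(x : F) x)).
  by rewrite addr0 [RHS](reindex_inj (addIr 1))/= big_split/= sumr_const.
apply: contra_eq_neq => two0; rewrite -(odd_double_half #|F|) oddF -muln2.
by rewrite natrD natrM two0 mulr0 addr0 oner_neq0.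
Qed.

Theorem theorem2p5 (F : finFieldType) (p q k m : nat) (a : nat -> F)
    (hq : #|F| = q) (hp : p \in [pchar F])
    (hk_odd : odd q -> (3 <= k <= q - 2)%N)
    (hk_even : ~~ odd q -> (4 <= k <= q - 3)%N)
    (hm : (1 <= m)%N) (ham : a m != 0)
    (hkp : (k <= p)%N \/ ((q + 1) %/ 2 <= k)%N) :
  (1 <= Nstar (complete_symmetric k m a))%N <->
  (* size = degree + 1 for nonzero polynomials, and size 0 = 0 *)
  size (reduction ('X^(k - 1) * \sum_(e < m.+1) a e *: 'X^e)) <> (k - 1).+1.
Proof.
have k_gt2 : (2 < k)%N by case: (boolP (odd q)) => [/hk_odd|/hk_even]; lia.
have kF : (k + 2 <= #|F|)%N.
  by rewrite hq; case: (boolP (odd q)) => [/hk_odd|/hk_even]; lia.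
have char2 : 2%:R = 0 :> F -> (k + 3 <= #|F|)%N.
  move=> /eqP two0; rewrite hq; have /hk_even : ~~ odd q; last lia.
  by rewrite -hq; apply: contraL two0; apply: odd_card_char_neq2.
have -> : (k - 1).+1 = k by lia.
have := @Nstar_gt0 F k m a; set P := reduction _ => NP.
apply: (iff_trans (NP _)); first lia.
split=> [[C cardC dd0] sP|sPk].
  (* In degree k - 1 every divided difference over k points is the leading coefficient. *)
  move/eqP: dd0; rewrite divdiff_horner ?cardC ?sP//.
  rewrite -sP -lead_coefE lead_coef_eq0 => /eqP P0.
  by move: k_gt2; rewrite -sP P0 size_poly0.
have [/existsP[C /andP[/eqP cardC /eqP dd0]]|] :=
  boolP [exists C : {set F}, (#|C| == k) && (divdiff (horner P) C == 0)].
  by exists C.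
rewrite negb_exists => /forallP nz; case: sPk.
have nz_divdiff (C : {set F}) : #|C| = k -> divdiff (horner P) C != 0.
  by move=> cardC; have := nz C; rewrite negb_and cardC eqxx.
have sPk : (size P <= k)%N.
  apply: divdiff_eq0_size; first exact: size_reduction.
  move=> C cardC; have [le_F2k|lt_2kF] := leqP #|F| k.*2.
    exact: (divdiff_next_eq0_large nz_divdiff).
  (* As 2k < q, the bound on k from below by (q + 1) / 2 fails. *)
  have le_kp : (k <= p)%N by case: hkp => //; lia.
  by apply: (divdiff_next_eq0_small nz_divdiff hp) => //; lia.
(* In degree below k - 1 all divided differences over k points would vanish. *)
apply/eqP; rewrite eqn_leq sPk/= leqNgt; apply/negP => lt_Pk.
have [|C _ cardC] := @exists_subset_card F setT k.
  by rewrite cardsT (leq_trans _ kF)// leq_addr.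
have := nz_divdiff C cardC; rewrite divdiff_horner ?cardC// nth_default ?eqxx//.
by rewrite -ltnS prednK// (ltn_trans _ k_gt2).
Qed.
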